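(* Let $(V,\Omega)$ be a symplectic vector space with canonical Liouville form $\theta$, given by $\theta_z(v_z)=\frac12\Omega(z,v)$ for $z,v\in V$. Let $a\in V$, let $\psi^a:V\to\mathbb{R}$ be $\psi^a(z)=\frac12\Omega(a,z)$, and let $\theta^a=\theta+{\rm d}\psi^a$. Then ${\rm Aut}(V,\theta^a)$ comprises precisely all maps $g:V\to V$ having the form $$g(z)=\gamma(z+a)-a\qquad(z\in V)$$ for some $\gamma\in{\rm Sp}(V,\Omega)$.
   Context: A symplectic vector space $(V,\Omega)$ is a finite-dimensional real vector space $V$ with a nonsingular alternating bilinear form $\Omega$. Regard $V$ as a smooth manifold; for $z,v\in V$ let $v_z\in T_zV$ be the tangent vector given by $v_z\psi=\frac{\rm d}{{\rm d}t}\psi(z+tv)|_{t=0}$ for smooth $\psi:V\to\mathbb{R}$. ${\rm Sp}(V,\Omega)$ is the group of linear automorphisms $g$ of $V$ with $\Omega(gx,gy)=\Omega(x,y)$ for all $x,y\in V$. For a one-form $\alpha$ on $V$, ${\rm Aut}(V,\alpha)$ is the group of all diffeomorphisms $g:V\to V$ with $g^*\alpha=\alpha$. *)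

(* Defs.v *)
From HB Require Import structures.
From mathcomp Require Import all_boot all_order all_algebra.
From mathcomp Require Import all_classical all_reals all_analysis.

Set Implicit Arguments.
Unset Strict Implicit.
Unset Printing Implicit Defensive.

Import Order.TTheory GRing.Theory Num.Theory.
Import numFieldNormedType.Exports.
Import VectorInternalTheory.

Local Open Scope classical_set_scope.
Local Open Scope ring_scope.

Section Smooth.
Variable R : realType.

(* For finite-dimensional X, this is the usual class C^k. *)
Fixpoint Ck (X Y : normedModType R) (k : nat) (f : X -> Y) : Prop :=
  if k is k'.+1 then
    (forall x, differentiable f x) /\ (forall v, Ck k' ('D_v f))
  else continuous f.

Variable V : vectType R.
Implicit Types (g : V -> V) (psi : V -> R) (z v : V).

(* A vectType carries no topology: the manifold structure of V is the one given
   by the global linear chart v2r : V -> 'rV[R]_(dim V), with inverse r2v. *)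
Definition in_chart g := v2r \o g \o r2v.

Definition smooth g := forall k, Ck k (in_chart g).

Definition diffeomorphism g :=
  smooth g /\ exists h, [/\ smooth h, cancel g h & cancel h g].

(* T_zV is identified with V through v_z <-> v. Hence the tangent map of g at z
   sends v_z to (tangent g z v)_(g z), and a one-form alpha is represented by
   the function (z, v) |-> alpha_z(v_z). *)
Definition tangent g z v : V := r2v ('d (in_chart g) (v2r z) (v2r v)).

Definition one_form := V -> V -> R.

Definition pullback g (alpha : one_form) : one_form :=
  fun z v => alpha (g z) (tangent g z v).

Definition tangent_vector z v psi : R :=
  derive1 (fun t : R => psi (z + t *: v)) 0.

Definition exterior_derivative psi : one_form :=
  fun z v => tangent_vector z v psi.

Definition Aut (alpha : one_form) : set (V -> V) :=
  [set g | diffeomorphism g /\ pullback g alpha = alpha].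

End Smooth.

Section Symplectic.
Variables (R : realType) (V : vectType R) (Om : {biscalar V}).

Definition symplectic : Prop :=
  (forall x, Om x x = 0) /\ (forall x, (forall y, Om x y = 0) -> x = 0).

Definition Sp : set (V -> V) :=
  [set g | [/\ linear g, bijective g & forall x y, Om (g x) (g y) = Om x y]].

Definition liouville : one_form V := fun z v => 2^-1 * Om z v.

Definition psi (a : V) : V -> R := fun z => 2^-1 * Om a z.

Definition liouville_shift (a : V) : one_form V :=
  fun z v => liouville z v + exterior_derivative (psi a) z v.

End Symplectic.

(* Main.v *)
From HB Require Import structures.
Require Import Defs.
From mathcomp Require Import all_boot all_order all_algebra.
From mathcomp Require Import all_classical all_reals all_analysis.
From mathcomp Require Import ring lra.

Set Implicit Arguments.
Unset Strict Implicit.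
Unset Printing Implicit Defensive.

Import Order.TTheory GRing.Theory Num.Theory.
Import numFieldNormedType.Exports.
Import VectorInternalTheory.
Local Open Scope classical_set_scope.
Local Open Scope ring_scope.

(** The shifted form is [theta^a_z(v) = Om (z + a) v / 2]: it is the Liouville
form recentred at [- a] (lemma [liouville_shiftE]).  Given this, an affine map
[z |-> gamma (z + a) - a] with [gamma] symplectic preserves it at once
([Sp_Aut]); the content lies in the converse.

Let [g] preserve the form, and write [Dg_z] for its tangent map, so that
[Om (g z + a) (Dg_z v) = Om (z + a) v] for all [z] and [v].  Differentiate in
the direction [u]:
[Om (Dg_z u) (Dg_z v) + Om (g z + a) (D_u D_v g (z)) = Om u v].
The second term is symmetric in [u] and [v] because second derivatives commute,
whereas the other two are antisymmetric; exchanging [u] and [v] and subtracting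
shows that each [Dg_z] is symplectic ([differential_symplectic]).  This is the
statement that [g] preserves the exterior derivative of the form.

Next, [g] must preserve the vector field dual to the form, which is the Euler
field centred at [- a].  Indeed
[Om (g z + a) (Dg_z v) = Om (z + a) v = Om (Dg_z (z + a)) (Dg_z v)],
and [Dg_z] is onto because [g] is a diffeomorphism, so nondegeneracy gives
[Dg_z (z + a) = g z + a].  Thus [g], recentred at [- a], satisfies Euler's
equation for functions homogeneous of degree one, and it is differentiable at
the centre itself.  Such a map equals its differential at the centre
([euler_homogeneous]): along each ray the quotient [f (t x) / t] is constant,
and its limit at [t = 0] is the derivative there.  So [g z + a] is the linear
map [Dg_(-a)] applied to [z + a], and this linear map is symplectic. *)

(** * Derivatives along lines and the symmetry of second derivatives *)

Lemma is_derive_along_line (R : realType) (E F : normedModType R) (f : E -> F)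
    (z u : E) (t : R) (l : F) :
  is_derive (z + t *: u) u f l -> is_derive t 1 (fun s => f (z + s *: u)) l.
Proof.
move=> [df <-].
have eqq : (fun h : R => h^-1 *: (f (z + (h *: 1 + t) *: u) - f (z + t *: u))) =
   (fun h => h^-1 *: (f (h *: u + (z + t *: u)) - f (z + t *: u))).
  by apply/funext => h; rewrite [h *: 1]mulr1 scalerDl addrCA.
apply: DeriveDef; first by rewrite /derivable /= eqq.
by rewrite /derive /= eqq.
Qed.

Lemma is_derive_translate (R : realType) (E F : normedModType R) (f : E -> F)
    (x u w : E) (l : F) :
  is_derive (x + w) u f l -> is_derive x u (fun y => f (y + w)) l.
Proof.
move=> [df <-].
have eqq : (fun h : R => h^-1 *: (f (h *: u + x + w) - f (x + w))) =
   (fun h => h^-1 *: (f (h *: u + (x + w)) - f (x + w))).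
  by apply/funext => h; rewrite addrA.
apply: DeriveDef; first by rewrite /derivable /= eqq.
by rewrite /derive /= eqq.
Qed.

Lemma mean_value_along_line (R : realType) (E : normedModType R)
    (f df : E -> R) (z u : E) (t : R) :
  0 < t -> (forall x, is_derive x u f (df x)) ->
  exists2 s, 0 < s < t & f (z + t *: u) - f z = t * df (z + s *: u).
Proof.
move=> t0 fE.
have dl (s : R) : is_derive s 1 (fun s => f (z + s *: u)) (df (z + s *: u)).
  exact: is_derive_along_line.
have cl : {within `[0, t], continuous (fun s => f (z + s *: u))}.
  apply: derivable_within_continuous => x _.
  exact: (@ex_derive _ _ _ _ _ _ _ (dl x)).
have [c] := MVT t0 (fun x _ => dl x) cl.
rewrite in_itv /= scale0r addr0 subr0 => c0t ->.
by exists c => //; rewrite mulrC.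
Qed.

(** The left-hand side is symmetric in [u] and [v], so that using this lemma in
both orders compares the two mixed derivatives at nearby points. *)
Lemma second_difference_mean_value (R : realType) (E : normedModType R)
    (f fu fuv : E -> R) (z u v : E) (t : R) :
  0 < t -> (forall x, is_derive x u f (fu x)) ->
  (forall x, is_derive x v fu (fuv x)) ->
  exists s r, [/\ 0 < s < t, 0 < r < t &
    f (z + t *: u + t *: v) - f (z + t *: u) - f (z + t *: v) + f z =
    t ^+ 2 * fuv (z + s *: u + r *: v)].
Proof.
move=> t0 fuE fuvE.
have dF x : is_derive x u (fun y => f (y + t *: v) - f y) (fu (x + t *: v) - fu x).
  exact: (is_deriveB (is_derive_translate (fuE _)) (fuE x)).
have [s st es] := mean_value_along_line z t0 dF.
have [r rt er] := mean_value_along_line (z + s *: u) t0 fuvE.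
exists s, r; split=> //.
rewrite expr2 -mulrA -er -es; ring.
Qed.

Lemma continuous_eq_at (R : realType) (E : normedModType R) (A B : E -> R) (z : E) :
  {for z, continuous A} -> {for z, continuous B} ->
  (forall d, 0 < d -> exists p q, [/\ `|p - z| < d, `|q - z| < d & A p = B q]) ->
  A z = B z.
Proof.
move=> cA cB AB.
apply/eqP; rewrite -subr_eq0 -normr_le0; apply/ler_addgt0Pl => e e0.
rewrite addr0.
have e20 : 0 < e / 2 by rewrite divr_gt0.
have hA : \forall p \near z, `|A z - A p| < e / 2.
  by move/cvgrPdist_lt : cA; apply.
have hB : \forall p \near z, `|B z - B p| < e / 2.
  by move/cvgrPdist_lt : cB; apply.
have : \forall p \near z, `|A z - A p| < e / 2 /\ `|B z - B p| < e / 2.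
  by near=> p; split; near: p.
move=> /nbhs_ballP[d /= d0 hd].
have [p [q [pd qd Apq]]] := AB d d0.
have [|h1 _] := hd p; first by rewrite -ball_normE /= distrC.
have [|_ h2] := hd q; first by rewrite -ball_normE /= distrC.
rewrite (splitr e) -(subrKA (A p)).
apply: (le_trans (ler_normD _ _)); rewrite lerD ?(ltW h1) //.
by rewrite Apq distrC ltW.
Unshelve. all: by end_near.
Qed.

(** The derivatives are named functions, characterized by hypotheses: with
explicit iterated derivatives, matching one mixed derivative against the other
would unfold both into limits. *)
Lemma scalar_schwarz (R : realType) (E : normedModType R)
    (f fu fv fuv fvu : E -> R) (z u v : E) :
  (forall x, is_derive x u f (fu x)) -> (forall x, is_derive x v f (fv x)) ->
  (forall x, is_derive x v fu (fuv x)) -> (forall x, is_derive x u fv (fvu x)) ->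
  {for z, continuous fuv} -> {for z, continuous fvu} ->
  fuv z = fvu z.
Proof.
move=> fuE fvE fuvE fvuE cuv cvu.
apply: (continuous_eq_at cuv cvu) => d d0.
(* The step [t] keeps the parallelogram with sides [t *: u], [t *: v] in the
   ball; the summand 1 avoids a division by zero. *)
pose t := d / (`|u| + `|v| + 1).
have n0 : 0 < `|u| + `|v| + 1 by rewrite ltr_wpDl ?addr_ge0.
have t0 : 0 < t by rewrite divr_gt0.
have near s r w w' : 0 < s < t -> 0 < r < t ->
    `|w| + `|w'| = `|u| + `|v| -> `|z + s *: w + r *: w' - z| < d.
  move=> /andP[s0 st] /andP[r0 rt] ww.
  have -> : z + s *: w + r *: w' - z = s *: w + r *: w'.
    by rewrite -(addrA z) [LHS]addrC addKr.
  apply: (le_lt_trans (ler_normD _ _)); rewrite !normrZ !gtr0_norm //.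
  apply: (@le_lt_trans _ _ (t * (`|u| + `|v|))).
    by rewrite -ww mulrDr lerD // ler_wpM2r // ltW.
  have -> : d = t * (`|u| + `|v| + 1) by rewrite divfK // gt_eqF.
  by rewrite ltr_pM2l // ltrDl.
have [s [r [st rt e1]]] := second_difference_mean_value z t0 fuE fuvE.
have [s' [r' [st' rt' e2]]] :=
  second_difference_mean_value z t0 fvE fvuE.
exists (z + s *: u + r *: v), (z + s' *: v + r' *: u); split.
- exact: near.
- by apply: near => //; exact: addrC.
have t2 : t ^+ 2 != 0 by rewrite expf_neq0 // gt_eqF.
by apply: (mulfI t2); rewrite -e1 -e2 (addrAC z); ring.
Qed.

Lemma is_derive_coord (R : realType) (E : normedModType R) n (f : E -> 'rV[R]_n)
    (x v : E) (l : 'rV[R]_n) i :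
  is_derive x v f l -> is_derive x v (fun y => f y 0 i) (l 0 i).
Proof.
move=> [df <-]; apply: DeriveDef; first exact: (derivable_mxP _ _ _).1.
by rewrite derive_mx // mxE.
Qed.

Lemma schwarz (R : realType) (E : normedModType R) n (f : E -> 'rV[R]_n)
    (z u v : E) :
  Ck 2 f -> 'D_v ('D_u f) z = 'D_u ('D_v f) z.
Proof.
move=> [df ddf].
have d1 x w : is_derive x w f ('D_w f x).
  exact/derivableP/diff_derivable.
have d2 x w w' : is_derive x w' ('D_w f) ('D_w' ('D_w f) x).
  by apply/derivableP/diff_derivable; have [] := ddf w.
have c2 w w' : continuous ('D_w' ('D_w f)) by have [_] := ddf w; apply.
(* The iterated derivatives are abstracted before passing to coordinates. *)
move: (d2 ^~ u ^~ v) (d2 ^~ v ^~ u) (d1 ^~ u) (d1 ^~ v) (c2 u v) (c2 v u).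
have cc (h : E -> 'rV[R]_n) i : continuous h -> continuous (fun y => h y 0 i).
  move=> ch y; apply: (@continuous_comp _ _ _ h (fun M : 'rV_n => M 0 i)); first exact: ch.
  exact: coord_continuous.
have key (fu fv fuv fvu : E -> 'rV[R]_n) :
    (forall x, is_derive x v fu (fuv x)) -> (forall x, is_derive x u fv (fvu x)) ->
    (forall x, is_derive x u f (fu x)) -> (forall x, is_derive x v f (fv x)) ->
    continuous fuv -> continuous fvu -> fuv z = fvu z.
  move=> h1 h2 h3 h4 h5 h6; apply/rowP => i.
  exact: (scalar_schwarz
    (fun x => is_derive_coord i (h3 x))
    (fun x => is_derive_coord i (h4 x))
    (fun x => is_derive_coord i (h1 x))
    (fun x => is_derive_coord i (h2 x))
    (cc _ i h5 z) (cc _ i h6 z)).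
exact: key.
Qed.

(** * Functions homogeneous of degree one *)

(** On [0 < t] the quotient [phi t / t] has derivative zero, so it keeps its
value [phi 1]; it is also the difference quotient of [phi] at [0]. *)
Lemma homogeneous_ode (R : realType) (phi dphi : R -> R) :
  (forall t : R, is_derive t 1 phi (dphi t)) -> (forall t, t * dphi t = phi t) ->
  phi 1 = dphi 0.
Proof.
move=> phiE ode.
have phi0 : phi 0 = 0 by rewrite -ode mul0r.
have lin (t : R) : 0 < t -> t < 1 -> phi t = t * phi 1.
  move=> t0 t1.
  pose q s := phi s * s^-1.
  have dq (s : R) : 0 < s -> is_derive s 1 q 0.
    move=> s0; have sn0 : s != 0 by rewrite gt_eqF.
    have h2 : is_derive s 1 (fun x : R => x^-1) (- s ^- 2 *: 1).
      have did : derivable (@id R) s 1 by exact: derivable_id.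
      apply: DeriveDef; first exact: (derivableV sn0 did).
      by rewrite (deriveV sn0 did) derive_id.
    apply: (is_derive_eq (is_deriveM (phiE s) h2)).
    by rewrite /= /GRing.scale /= -(ode s); field.
  have cq : {within `[t, 1], continuous q}.
    apply: derivable_within_continuous => x; rewrite in_itv /= => /andP[tx _].
    exact: (@ex_derive _ _ _ _ _ _ _ (dq x (lt_le_trans t0 tx))).
  have dq' x : x \in `]t, 1[%R -> is_derive x 1 q ((fun=> 0) x).
    by rewrite in_itv /= => /andP[tx _]; apply: dq; exact: lt_trans tx.
  have [c _] := MVT t1 dq' cq.
  rewrite mul0r /q invr1 mulr1 => /eqP; rewrite subr_eq0 => /eqP ->.
  by rewrite mulrC divfK // gt_eqF.
have [dphi0 <-] := phiE 0.
have hl : h^-1 *: (phi (h *: 1 + 0) - phi 0) @[h --> (0 : R)^'] --> 'D_1 phi 0.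
  exact: dphi0.
have hl' : h^-1 *: (phi (h *: 1 + 0) - phi 0) @[h --> (0 : R)^'+] --> 'D_1 phi 0.
  exact: cvg_dnbhs_at_right.
have hc : h^-1 *: (phi (h *: 1 + 0) - phi 0) @[h --> (0:R)^'+] --> phi 1.
  apply: cvg_near_cst; near=> h.
  have h0 : 0 < h by [].
  rewrite addr0 [h *: 1]mulr1 phi0 subr0 lin //.
  by rewrite [_ *: _]mulKf // gt_eqF.
exact: (cvg_unique _ hc hl').
Unshelve. all: by end_near.
Qed.

(** Differentiability at the origin is what excludes homogeneous maps that are
not linear, such as the norm. *)
Lemma euler_homogeneous (R : realType) (E : normedModType R) n
    (f : E -> 'rV[R]_n) :
  (forall x, differentiable f x) -> (forall x, 'd f x x = f x) ->
  forall x, f x = 'd f 0 x.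
Proof.
move=> df euler x; apply/rowP => i.
have dphi (t : R) :
    is_derive t 1 (fun s => f (0 + s *: x) 0 i) ('d f (0 + t *: x) x 0 i).
  apply/is_derive_coord/is_derive_along_line.
  by apply: DeriveDef; [exact: diff_derivable | rewrite deriveE].
have ode (t : R) : t * 'd f (0 + t *: x) x 0 i = f (0 + t *: x) 0 i.
  by rewrite add0r -[in RHS]euler linearZ mxE.
have := homogeneous_ode dphi ode.
by rewrite !add0r scale1r scale0r.
Qed.

(** * Bilinear forms and affine maps in the linear chart *)

(** In the coordinates of the chart, a bilinear form is a polynomial: this
gives the product rule below without any topology on [V]. *)
Lemma biscalar_coord (R : realType) (V : vectType R) (Om : {biscalar V})
    (x y : 'rV[R]_(dim V)) :
  Om (r2v x) (r2v y) =
  \sum_i \sum_j x 0 i * y 0 j * Om (r2v (delta_mx 0 i)) (r2v (delta_mx 0 j)).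
Proof.
rewrite [in LHS](row_sum_delta x) linear_sum linear_sumlz.
apply: eq_bigr => i _.
rewrite linearZ /= linearZl_LR /= [in LHS](row_sum_delta y) linear_sum linear_sumr.
rewrite mulr_sumr; apply: eq_bigr => j _.
by rewrite linearZ /= linearZr_LR /= mulrA.
Qed.

Lemma is_derive_biscalar (R : realType) (V : vectType R) (Om : {biscalar V})
    (E : normedModType R) (f g : E -> 'rV[R]_(dim V)) (x v : E)
    (df dg : 'rV[R]_(dim V)) :
  is_derive x v f df -> is_derive x v g dg ->
  is_derive x v (fun y => Om (r2v (f y)) (r2v (g y)))
    (Om (r2v df) (r2v (g x)) + Om (r2v (f x)) (r2v dg)).
Proof.
move=> fE gE.
pose c i j := Om (r2v (delta_mx 0 i)) (r2v (delta_mx 0 j)).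
have h i j : is_derive x v (fun y => f y 0 i * g y 0 j * c i j)
   ((df 0 i * g x 0 j + f x 0 i * dg 0 j) * c i j).
  have hf := is_derive_coord i fE.
  have hg := is_derive_coord j gE.
  apply: (is_derive_eq (is_deriveM (is_deriveM hf hg) (is_derive_cst (c i j) x v))).
  by rewrite /GRing.scale /=; ring.
have -> : (fun y => Om (r2v (f y)) (r2v (g y))) =
    \sum_i \sum_j (fun y => f y 0 i * g y 0 j * c i j).
  apply/funext => y; rewrite biscalar_coord fct_sumE.
  by apply: eq_bigr => i _; rewrite fct_sumE.
have hs := is_derive_sum (fun i => is_derive_sum (h i)).
apply: (is_derive_eq hs).
rewrite !biscalar_coord -big_split; apply: eq_bigr => i _.
rewrite -big_split; apply: eq_bigr => j _ /=.
by rewrite /c mulrDl.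
Qed.

Lemma linear_rV_continuous (R : realType) (F : normedModType R) n
    (f : {linear 'rV[R]_n -> F}) : continuous f.
Proof.
have -> : (f : _ -> _) = \sum_(i < n) (fun x : 'rV_n => x 0 i *: f (delta_mx 0 i)).
  apply/funext => x; rewrite fct_sumE [in LHS](row_sum_delta x) linear_sum.
  by apply: eq_bigr => i _; rewrite linearZ.
move=> x; apply: differentiable_continuous; apply: differentiable_sum => i.
by apply: differentiableZl; exact: differentiable_coord.
Qed.

Lemma Ck_cst (R : realType) (E F : normedModType R) k (c : F) :
  Ck k (fun _ : E => c).
Proof.
elim: k c => [|k IH] c /=; first by move=> x; exact: cvg_cst.
split=> [x|v]; first exact: differentiable_cst.
have -> : 'D_v (fun _ : E => c) = (fun _ => 0) by apply/funext => x; exact: derive_cst.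
exact: IH.
Qed.

Lemma is_diff_affine (R : realType) (F : normedModType R) n
    (f : {linear 'rV[R]_n -> F}) (c : F) (x : 'rV[R]_n) :
  is_diff x (fun y => f y + c) f.
Proof.
have cf : continuous f by exact: linear_rV_continuous.
have h : is_diff x f f.
  by apply: DiffDef; [exact: linear_differentiable | rewrite diff_lin].
have := is_diffD h (is_diff_cst c x).
by rewrite addr0.
Qed.

Lemma Ck_affine (R : realType) (F : normedModType R) n
    (f : {linear 'rV[R]_n -> F}) (c : F) k : Ck k (fun y => f y + c).
Proof.
have daff x := is_diff_affine f c x.
case: k => [|k] /=.
  by move=> x; apply: differentiable_continuous; have [] := daff x.
split=> [x|v]; first by have [] := daff x.
have -> : 'D_v (fun y => f y + c) = (fun _ => f v).
  apply/funext => x; rewrite deriveE; first by rewrite diff_val.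
  by have [] := daff x.
exact: Ck_cst.
Qed.

Lemma differential_cancel (R : realType) (E F : normedModType R)
    (G : F -> E) (H : E -> F) (y v : E) :
  cancel H G -> differentiable H y -> differentiable G (H y) ->
  'd G (H y) ('d H y v) = v.
Proof.
move=> HK dH dG.
have GHE : G \o H = id by apply/funext => x; exact: HK.
have dGH : 'd (G \o H) y v = v by rewrite GHE diff_val.
by move: dGH; rewrite (diff_comp dH dG).
Qed.

(** * Maps preserving the shifted Liouville form *)

Section SymplecticSpace.
Variables (R : realType) (V : vectType R) (Om : {biscalar V}).
Hypothesis Om_symplectic : symplectic Om.

(** The differential of the linear function [psi^a] is itself, so that the two
terms of the shifted form combine into one pairing. *)
Lemma liouville_shiftE (a z v : V) :
  liouville_shift Om a z v = 2^-1 * Om (z + a) v.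
Proof.
rewrite /liouville_shift /liouville /exterior_derivative /tangent_vector.
rewrite derive1E.
have -> : (fun t : R => psi Om a (z + t *: v)) =
   (fun t => t * psi Om a v + psi Om a z).
  apply/funext => t; rewrite /psi linearDr linearZr_LR /=; ring.
have h : is_derive (0 : R) 1 (fun t : R => t * psi Om a v + psi Om a z) (psi Om a v).
  have h1 := is_deriveM (is_derive_id (0 : R) (1 : R))
                        (is_derive_cst (psi Om a v) (0 : R) (1 : R)).
  apply: (is_derive_eq (is_deriveD h1 (is_derive_cst (psi Om a z) (0 : R) (1 : R)))).
  by rewrite /GRing.scale /=; ring.
by rewrite (@derive_val _ _ _ _ _ _ _ h) /psi linearDl mulrDr.
Qed.

Lemma symplectic_antisym x y : Om x y = - Om y x.
Proof.
have [alt _] := Om_symplectic.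
by have := alt (x + y); rewrite linearDl !linearDr !alt addr0 add0r => /eqP;
  rewrite addr_eq0 => /eqP.
Qed.

Lemma linear_chart (gamma : V -> V) :
  linear gamma -> linear (v2r \o gamma \o r2v).
Proof. by move=> lg k x y /=; rewrite linearP lg linearP. Qed.

Lemma in_chart_affine (gamma : V -> V) (a : V) : linear gamma ->
  in_chart (fun z => gamma (z + a) - a) =
  (fun x => (v2r \o gamma \o r2v) x + v2r (gamma a - a)).
Proof.
move=> lg; apply/funext => x; rewrite /in_chart /= -linearD addrA; congr (v2r (_ - _)).
by have := lg 1 (r2v x) a; rewrite !scale1r.
Qed.

Lemma smooth_affine (gamma : V -> V) (a : V) :
  linear gamma -> smooth (fun z => gamma (z + a) - a).
Proof.
move=> lg k; rewrite in_chart_affine //.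
pose L := HB.pack_for {linear 'rV[R]_(dim V) -> 'rV[R]_(dim V)} (v2r \o gamma \o r2v)
  (GRing.isLinear.Build _ _ _ _ _ (linear_chart lg)).
exact: (@Ck_affine R _ _ L).
Qed.

Lemma tangent_affine (gamma : V -> V) (a z v : V) :
  linear gamma -> tangent (fun z => gamma (z + a) - a) z v = gamma v.
Proof.
move=> lg; rewrite /tangent in_chart_affine //.
pose L := HB.pack_for {linear 'rV[R]_(dim V) -> 'rV[R]_(dim V)} (v2r \o gamma \o r2v)
  (GRing.isLinear.Build _ _ _ _ _ (linear_chart lg)).
have dL := is_diff_affine L (v2r (gamma a - a)) (v2r z).
by rewrite (@diff_val _ _ _ _ _ _ _ dL) /= !v2rK.
Qed.

Lemma Sp_Aut (a : V) (gamma : V -> V) :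
  Sp Om gamma -> Aut (liouville_shift Om a) (fun z => gamma (z + a) - a).
Proof.
move=> [lg [gamma' gK Kg] Omg].
have lg' : linear gamma'.
  move=> k x y; apply: (can_inj gK).
  by rewrite lg !Kg.
split.
  split; first exact: smooth_affine.
  exists (fun z => gamma' (z + a) - a); split; first exact: smooth_affine.
  - by move=> z; rewrite subrK gK addrK.
  - by move=> z; rewrite subrK Kg addrK.
apply/funext => z; apply/funext => v.
by rewrite /pullback tangent_affine // !liouville_shiftE subrK Omg.
Qed.

(** Differentiating the hypothesis along [u] leaves one term with a second
derivative of [G]; Schwarz's theorem makes it symmetric, and antisymmetrization
removes it.  Here [G] is a map read in the chart, and [- w] stands for the point
at which the form vanishes. *)
Lemma differential_symplectic (G : 'rV[R]_(dim V) -> 'rV[R]_(dim V)) w :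
  Ck 2 G ->
  (forall x v, Om (r2v (G x + w)) (r2v ('d G x v)) = Om (r2v (x + w)) (r2v v)) ->
  forall x u v, Om (r2v ('d G x u)) (r2v ('d G x v)) = Om (r2v u) (r2v v).
Proof.
move=> G2 inv x u v; have [dG ddG] := G2.
have dGE p q : is_derive p q G ('d G p q).
  by apply: DeriveDef; [exact: diff_derivable | rewrite deriveE].
have key p q : Om (r2v ('d G x p)) (r2v ('d G x q)) +
    Om (r2v (G x + w)) (r2v ('D_p ('D_q G) x)) = Om (r2v p) (r2v q).
  have translate h l : is_derive x p h l ->
      is_derive x p (fun y : 'rV[R]_(dim V) => h y + w : 'rV[R]_(dim V)) l.
    move=> hl; apply: (is_derive_eq (is_deriveD hl (is_derive_cst w x p))).
    by rewrite addr0.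
  have ddGE : is_derive x p (fun y => 'd G y q) ('D_p ('D_q G) x).
    have -> : (fun y => 'd G y q) = 'D_q G.
      by apply/funext => y; rewrite deriveE.
    by apply/derivableP/diff_derivable; have [] := ddG q.
  have lhs := is_derive_biscalar Om (translate _ _ (dGE x p)) ddGE.
  have rhs := is_derive_biscalar Om (translate _ _ (is_derive_id x p))
                                    (is_derive_cst q x p).
  move: lhs; have -> : (fun y => Om (r2v (G y + w)) (r2v ('d G y q))) =
            (fun y => Om (r2v (y + w)) (r2v q)).
    by apply/funext => y; rewrite inv.
  move=> [_ lhs]; case: rhs => _; rewrite lhs => ->.
  by rewrite linear0 linear0r addr0.
have e1 := key u v; have e2 := key v u.
rewrite (schwarz x u v G2) in e2.
(* Antisymmetry turns the exchanged identity [e2] into one that differs from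
   [e1] by the sign of the second-derivative term. *)
rewrite [Om (r2v ('d G x v)) _]symplectic_antisym [RHS]symplectic_antisym in e2.
lra.
Qed.

(** The map [g] is affine: it is its tangent map at [- a], conjugated by the
translation that takes the centre [- a] to the origin. *)
Lemma liouville_preserving_affine (g : V -> V) (a : V) :
  Aut (liouville_shift Om a) g ->
  forall z, g z = tangent g (- a) (z + a) - a.
Proof.
move=> [[sg [h [sh hK Kh]]] pg].
pose G := in_chart g; pose H := in_chart h; pose w := v2r a.
have G2 : Ck 2 G by exact: sg.
have dG x : differentiable G x by have [] := G2.
have dH x : differentiable H x by have [] := sh 1.
have inv x v : Om (r2v (G x + w)) (r2v ('d G x v)) = Om (r2v (x + w)) (r2v v).
  have Ga : r2v (G x + w) = g (r2v x) + a by rewrite linearD /w /G /in_chart /= !v2rK.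
  have xa : r2v (x + w) = r2v x + a by rewrite linearD /w /= v2rK.
  have := congr1 (fun al => al (r2v x) (r2v v)) pg.
  rewrite /pullback !liouville_shiftE /tangent !r2vK Ga xa => /mulfI; apply.
  by rewrite invr_eq0.
have symp := differential_symplectic G2 inv.
have GH : cancel H G by move=> y; rewrite /G /H /in_chart /= v2rK Kh r2vK.
have HG : cancel G H by move=> y; rewrite /G /H /in_chart /= v2rK hK r2vK.
have surj x v : exists u, 'd G x u = v.
  exists ('d H (G x) v).
  have := differential_cancel v GH (dH (G x)) (dG (H (G x))).
  by rewrite (HG x).
(* [symp] moves [x + w] under the differential, and surjectivity lets
   nondegeneracy apply. *)
have euler x : 'd G x (x + w) = G x + w.
  apply/eqP; rewrite -subr_eq0; apply/eqP; apply: (can_inj r2vK); rewrite linear0.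
  have [_ nondeg] := Om_symplectic; apply: nondeg => y.
  have [u <-] : exists u, r2v ('d G x u) = y.
    by have [u hu] := surj x (v2r y); exists u; rewrite hu v2rK.
  by rewrite linearB linearBl symp inv subrr.
(* [F] is [G] with its centre [- w] moved to the origin. *)
pose F x := G (x - w) + w.
have dF x : is_diff x F ('d G (x - w)).
  have ds : is_diff x (fun y => y - w) id by exact: (is_diff_affine idfun (- w) x).
  have dGx : is_diff (x - w) G ('d G (x - w)) by apply: DiffDef.
  have := is_diffD (is_diff_comp ds dGx) (is_diff_cst w x).
  by rewrite addr0.
have FE : forall x, F x = 'd F 0 x.
  apply: euler_homogeneous => x; first by have [] := dF x.
  by rewrite (@diff_val _ _ _ _ _ _ _ (dF x)) -[X in 'd G _ X](subrK w) euler.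
move=> z; have := FE (v2r z + w).
rewrite (@diff_val _ _ _ _ _ _ _ (dF 0)) /F addrK sub0r => e.
have Ew : - w = v2r (- a) by rewrite linearN.
have Ez : v2r z + w = v2r (z + a) by rewrite linearD.
have Gz : r2v (G (v2r z)) = g z by rewrite /G /in_chart /= !v2rK.
have : r2v (G (v2r z)) = r2v ('d G (- w) (v2r z + w)) - a.
  by rewrite -e linearD /= [r2v w]v2rK addrK.
by rewrite Gz Ew Ez.
Qed.

End SymplecticSpace.

Theorem theorem1p1 (R : realType) (V : vectType R) (Om : {biscalar V})
    (Om_symplectic : symplectic Om) (a : V) :
  Aut (liouville_shift Om a) =
  [set g : V -> V | exists2 gamma : V -> V, Sp Om gamma &
                      forall z, g z = gamma (z + a) - a].
Proof.
apply/seteqP; split=> g /=.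
- move=> gA; have ge := liouville_preserving_affine Om_symplectic gA.
  exists (tangent g (- a)) => //.
  have [[sg [h [sh hK Kh]]] pg] := gA.
  have lt : linear (tangent g (- a)).
    by move=> k x y; rewrite /tangent !linearP.
  have gE z : tangent g (- a) z = g (z - a) + a by rewrite ge subrK subrK.
  split=> //.
  + exists (fun z => h (z - a) + a) => z; first by rewrite gE addrK hK subrK.
    by rewrite gE addrK Kh subrK.
  + move=> x y.
    (* Since [g] is affine, its tangent map does not depend on the point. *)
    have tg : tangent g (x - a) y = tangent g (- a) y.
      have -> : g = fun z => tangent g (- a) (z + a) - a by apply/funext.
      by rewrite !tangent_affine.
    have := congr1 (fun al => al (x - a) y) pg.
    rewrite /pullback !liouville_shiftE tg -gE subrK => /mulfI; apply.
    by rewrite invr_eq0.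
- move=> [gamma gS ge].
  have -> : g = fun z => gamma (z + a) - a by apply/funext.
  exact: Sp_Aut.
Qed.
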